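(* Let $\mathcal{C}$ be an idempotent-complete category, let $R,S,T$ be monads on $\mathcal{C}$, and let $\lambda \colon TS \Rightarrow ST$, $\sigma \colon SR \Rightarrow RS$, $\tau \colon TR \Rightarrow RT$ be weak distributive laws satisfying the Yang–Baxter equation $\sigma T \circ S\tau \circ \lambda R = R\lambda \circ \tau S \circ T\sigma$. Let $R \bullet_\sigma S$ be the weak composite monad of $\sigma$, with underlying functor $H$ and splitting maps $\pi^\sigma \colon RS \Rightarrow H$, $\iota^\sigma \colon H \Rightarrow RS$. Then $$\phi \triangleq \pi^\sigma T \circ R\lambda \circ \tau S \circ T\iota^\sigma \colon TH \Rightarrow HT$$ is a weak distributive law from the monad $T$ over the monad $R\bullet_\sigma S$ (i.e. of type $[R\bullet_\sigma S, T]$). If, additionally, $\tau$ and $\lambda$ are distributive laws, then $\phi$ is a distributive law.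
   Context: $\mathcal{C}$ is idempotent complete: every idempotent morphism (hence every idempotent natural transformation between endofunctors) splits. A monad is $(T,\eta^T,\mu^T)$. For endofunctors $A,B$, $[A,B]$ denotes the type of natural transformations $BA \Rightarrow AB$. For monads $A,B$, a natural transformation $\lambda \colon BA \Rightarrow AB$ is a distributive law if it satisfies $(\eta^+)$ $\lambda \circ B\eta^A = \eta^A B$, $(\mu^+)$ $\lambda \circ B\mu^A = \mu^A B \circ A\lambda \circ \lambda A$, $(\eta^-)$ $\lambda \circ \eta^B A = A\eta^B$, $(\mu^-)$ $\lambda \circ \mu^B A = A\mu^B \circ \lambda B \circ B\lambda$; it is a weak distributive law if it satisfies $(\eta^+)$, $(\mu^+)$, $(\mu^-)$. For a weak distributive law $\sigma \colon SR \Rightarrow RS$, the idempotent $\kappa^\sigma \triangleq R\mu^S \circ \sigma S \circ \eta^S RS \colon RS \Rightarrow RS$ splits as $\kappa^\sigma = \iota^\sigma \circ \pi^\sigma$ with $\pi^\sigma \circ \iota^\sigma = 1_H$, where $\pi^\sigma \colon RS \Rightarrow H$, $\iota^\sigma \colon H \Rightarrow RS$; the weak composite monad is $R\bullet_\sigma S \triangleq (H,\ \pi^\sigma \circ \eta^R\eta^S,\ \pi^\sigma \circ \mu^R\mu^S \circ R\sigma S \circ \iota^\sigma\iota^\sigma)$. *)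

(* Defs.v *)
From Stdlib Require Import ssreflect ClassicalEpsilon.

Set Implicit Arguments.
Unset Strict Implicit.
Unset Printing Implicit Defensive.

Declare Scope cat_scope.
Delimit Scope cat_scope with cat.
Local Open Scope cat_scope.

Record category := Category {
  obj :> Type;
  hom : obj -> obj -> Type;
  idm : forall X, hom X X;
  comp : forall X Y Z, hom Y Z -> hom X Y -> hom X Z;
  comp_idl : forall X Y (f : hom X Y), comp (idm Y) f = f;
  comp_idr : forall X Y (f : hom X Y), comp f (idm X) = f;
  compA : forall W X Y Z (h : hom Y Z) (g : hom X Y) (f : hom W X),
    comp (comp h g) f = comp h (comp g f)
}.

Arguments hom {c}.
Arguments idm {c}.
Arguments comp {c X Y Z}.

Notation "g ∘ f" := (comp g f) (at level 41, right associativity) : cat_scope.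

Record functor (C D : category) := Functor {
  fobj :> C -> D;
  fmap : forall X Y : C, hom X Y -> hom (fobj X) (fobj Y);
  fmap_id : forall X, fmap (idm X) = idm (fobj X);
  fmap_comp : forall X Y Z (g : hom Y Z) (f : hom X Y),
    fmap (g ∘ f) = fmap g ∘ fmap f
}.

Arguments fmap {C D} _ {X Y} _.

Notation endofunctor C := (functor C C).

Definition fid (C : category) : endofunctor C.
Proof. now exists (fun X => X) (fun X Y f => f). Defined.

Definition fcomp (C D E : category) (G : functor D E) (F : functor C D) :
  functor C E.
Proof.
exists (fun X => G (F X)) (fun X Y f => fmap G (fmap F f)).
- now intros X; rewrite !fmap_id.
- now intros X Y Z g f; rewrite !fmap_comp.
Defined.

Record nattrans (C D : category) (F G : functor C D) := Nattrans {
  component :> forall X : C, hom (F X) (G X);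
  natural : forall X Y (f : hom X Y),
    component Y ∘ fmap F f = fmap G f ∘ component X
}.

(* [comp_eq E z] is the equation [E] precomposed with [z], so that [E] can be *)
(* rewritten inside a right-nested composite.                                 *)
Lemma comp_eq (C : category) (X Y Z : C) (g : hom Y Z) (f : hom X Y) (h : hom X Z) :
  g ∘ f = h -> forall W (z : hom W X), g ∘ f ∘ z = h ∘ z.
Proof. now intros <- W z; rewrite compA. Qed.

Ltac cat_norm := repeat first [rewrite !compA | rewrite !fmap_comp].
Tactic Notation "crw" uconstr(E) :=
  first [rewrite E | rewrite (comp_eq E)]; cat_norm.

Definition vcomp (C D : category) (F G H : functor C D)
  (b : nattrans G H) (a : nattrans F G) : nattrans F H.
Proof.
exists (fun X => b X ∘ a X).
now intros X Y f; rewrite compA natural -compA natural compA.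
Defined.

(* Horizontal composition: for a : F => F' and b : G => G', the               *)
(* transformation ab : FG => F'G'.                                            *)
Definition hcomp (C D E : category) (F F' : functor D E) (G G' : functor C D)
  (a : nattrans F F') (b : nattrans G G') : nattrans (fcomp F G) (fcomp F' G').
Proof.
exists (fun X => a (G' X) ∘ fmap F (b X)).
intros X Y f; simpl; rewrite compA -fmap_comp (natural b f) fmap_comp.
now rewrite -!compA (natural a (fmap G' f)).
Defined.

(* Equality of natural transformations is stated componentwise throughout: the *)
(* whiskerings F a and a F have components [fmap F (a X)] and [a (F X)], and   *)
(* no coercion along associativity of functor composition is needed.           *)
Record monad (C : category) := Monad {
  mfun :> endofunctor C;
  eta : nattrans (fid C) mfun;
  mu : nattrans (fcomp mfun mfun) mfun;
  mu_etal : forall X, mu X ∘ eta (mfun X) = idm (mfun X);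
  mu_etar : forall X, mu X ∘ fmap mfun (eta X) = idm (mfun X);
  mu_mu : forall X, mu X ∘ mu (mfun X) = mu X ∘ fmap mfun (mu X)
}.

Arguments eta {C}.
Arguments mu {C}.

Definition idempotent (C : category) (X : C) (k : hom X X) := k ∘ k = k.

Definition splits (C : category) (X : C) (k : hom X X) :=
  exists (Y : C) (p : hom X Y) (i : hom Y X), i ∘ p = k /\ p ∘ i = idm Y.

Definition idempotent_complete (C : category) :=
  forall (X : C) (k : hom X X), idempotent k -> splits k.

Record splitting (C : category) (F : endofunctor C) (k : nattrans F F) :=
  Splitting {
    split_fun : endofunctor C;
    split_pi : nattrans F split_fun;
    split_iota : nattrans split_fun F;
    iota_pi : forall X, split_iota X ∘ split_pi X = k X;
    pi_iota : forall X, split_pi X ∘ split_iota X = idm (split_fun X)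
  }.

Lemma idempotent_nattrans_splits (C : category) (F : endofunctor C)
    (k : nattrans F F) :
  idempotent_complete C -> (forall X, idempotent (k X)) -> inhabited (splitting k).
Proof.
intros HC kk.
assert (ch : forall X, {Y : C & {p : hom (F X) Y & {i : hom Y (F X) |
    i ∘ p = k X /\ p ∘ i = idm Y}}}).
{ intros X.
  destruct (constructive_indefinite_description _ (HC _ _ (kk X))) as [Y HY].
  destruct (constructive_indefinite_description _ HY) as [p Hp].
  destruct (constructive_indefinite_description _ Hp) as [i Hi].
  now exists Y, p, i. }
pose (H := fun X => projT1 (ch X)).
pose (p := fun X => projT1 (projT2 (ch X)) : hom (F X) (H X)).
pose (i := fun X => proj1_sig (projT2 (projT2 (ch X))) : hom (H X) (F X)).
assert (ip : forall X, i X ∘ p X = k X)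
  by exact (fun X => proj1 (proj2_sig (projT2 (projT2 (ch X))))).
assert (pi : forall X, p X ∘ i X = idm (H X))
  by exact (fun X => proj2 (proj2_sig (projT2 (projT2 (ch X))))).
clearbody H p i; clear ch.
assert (ik : forall X, k X ∘ i X = i X)
  by now intros X; rewrite -ip compA pi comp_idr.
assert (pk : forall X, p X ∘ k X = p X)
  by now intros X; rewrite -ip -compA pi comp_idl.
unshelve epose (HF := @Functor C C H (fun X Y f => p Y ∘ fmap F f ∘ i X) _ _).
- now intros X; simpl; rewrite fmap_id comp_idl pi.
- intros X Y Z g f; simpl; cat_norm.
  now crw (ip Y); crw (natural k f); crw (ik X).
- constructor; unshelve eapply (@Splitting C F k HF).
  + exists p; intros X Y f; simpl; cat_norm.
    now crw (ip X); rewrite -(natural k f) -compA pk.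
  + exists i; intros X Y f; simpl; cat_norm.
    now crw (ip Y); crw (natural k f); crw (ik X).
  + exact ip.
  + exact pi.
Qed.

(* The type [A, B] of natural transformations BA => AB. *)
Definition bracket (C : category) (A B : endofunctor C) :=
  nattrans (fcomp B A) (fcomp A B).

Section Laws.
Variables (C : category) (A B : monad C) (l : bracket A B).

Definition eta_plus := forall X, l X ∘ fmap B (eta A X) = eta A (B X).

Definition mu_plus := forall X,
  l X ∘ fmap B (mu A X) = mu A (B X) ∘ fmap A (l X) ∘ l (A X).

Definition eta_minus := forall X, l X ∘ eta B (A X) = fmap A (eta B X).

Definition mu_minus := forall X,
  l X ∘ mu B (A X) = fmap A (mu B X) ∘ l (B X) ∘ fmap B (l X).

Definition weak_distributive_law := eta_plus /\ mu_plus /\ mu_minus.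

Definition distributive_law := eta_plus /\ mu_plus /\ eta_minus /\ mu_minus.

End Laws.

Arguments weak_distributive_law {C} A B l.
Arguments distributive_law {C} A B l.

Definition yang_baxter (C : category) (R S T : endofunctor C)
    (lam : bracket S T) (sigma : bracket R S) (tau : bracket R T) :=
  forall X, sigma (T X) ∘ fmap S (tau X) ∘ lam (R X)
          = fmap R (lam X) ∘ tau (S X) ∘ fmap T (sigma X).

Definition kappa (C : category) (R S : monad C) (sigma : bracket R S) :
  nattrans (fcomp R S) (fcomp R S).
Proof.
exists (fun X => fmap R (mu S X) ∘ sigma (S X) ∘ eta S (R (S X))).
intros X Y f; simpl; cat_norm.
pose proof (natural (eta S) (fmap R (fmap S f))) as E1; simpl in E1.
pose proof (natural sigma (fmap S f)) as E2; simpl in E2.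
pose proof (natural (mu S) f) as E3; simpl in E3.
now crw E1; crw E2; rewrite -!compA -!fmap_comp E3.
Defined.

(* If m is associative and e is only a right unit for m, then k = m . eF is    *)
(* idempotent and any splitting of k carries a monad structure.                *)
Section Premonad.
Variables (C : category) (F : endofunctor C).
Variables (e : nattrans (fid C) F) (m : nattrans (fcomp F F) F).
Variable k : nattrans F F.
Hypothesis mA : forall X, m X ∘ m (F X) = m X ∘ fmap F (m X).
Hypothesis me : forall X, m X ∘ fmap F (e X) = idm (F X).
Hypothesis kE : forall X, m X ∘ e (F X) = k X.

Lemma premonad_km X : k X ∘ m X = m X ∘ k (F X).
Proof.
pose proof (natural e (m X)) as E; simpl in E.
rewrite -!kE; cat_norm; rewrite E.
now rewrite -!compA mA.
Qed.

Lemma premonad_mk X : m X ∘ fmap F (k X) = m X.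
Proof.
rewrite -kE; cat_norm; rewrite -compA -mA compA.
now rewrite me comp_idr.
Qed.

Lemma premonad_ke X : k X ∘ e X = e X.
Proof.
pose proof (natural e (e X)) as E; simpl in E.
now rewrite -kE compA E -compA me comp_idl.
Qed.

Lemma premonad_kk X : idempotent (k X).
Proof.
unfold idempotent; rewrite -{2}(kE X).
now rewrite -compA premonad_km compA premonad_ke kE.
Qed.

Variable s : splitting k.
Let H := split_fun s.
Let pi := split_pi s.
Let iota := split_iota s.
Let n X := pi X ∘ m X ∘ hcomp iota iota X.

Let hiota X : hcomp iota iota X = fmap F (iota X) ∘ iota (H X).
Proof. exact (natural iota (iota X)). Qed.

Let k_iota X : k X ∘ iota X = iota X.
Proof.
now unfold iota; rewrite -(iota_pi s) compA pi_iota comp_idr.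
Qed.

Let pi_k X : pi X ∘ k X = pi X.
Proof.
now unfold pi; rewrite -(iota_pi s) -compA pi_iota comp_idl.
Qed.

Let iota_n X : iota X ∘ n X = m X ∘ hcomp iota iota X.
Proof.
unfold n; rewrite (comp_eq (iota_pi s X)) (comp_eq (premonad_km X)) compA.
now simpl; rewrite (comp_eq (k_iota (F X))).
Qed.

Lemma premonad_split_etal X : n X ∘ pi (H X) ∘ e (H X) = idm (H X).
Proof.
unfold n; rewrite hiota; cat_norm.
rewrite (comp_eq (iota_pi s (H X))) premonad_ke.
pose proof (natural e (iota X)) as E; simpl in E.
rewrite -E (comp_eq (kE X)) k_iota; exact (pi_iota s X).
Qed.

Lemma premonad_split_etar X : n X ∘ fmap H (pi X ∘ e X) = idm (H X).
Proof.
unfold n; simpl; rewrite !compA -fmap_comp.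
rewrite (comp_eq (iota_pi s X)) premonad_ke (natural iota (e X)).
rewrite (comp_eq (me X)) comp_idl; exact (pi_iota s X).
Qed.

Lemma premonad_split_assoc X : n X ∘ n (H X) = n X ∘ fmap H (n X).
Proof.
transitivity (pi X ∘ m X ∘ m (F X) ∘ fmap F (hcomp iota iota X) ∘ iota (H (H X))).
- unfold n at 1; rewrite hiota !compA iota_n hiota.
  rewrite (comp_eq (eq_sym (natural m (iota X)))) compA; simpl.
  now rewrite fmap_comp !compA.
- unfold n at 1; simpl (hcomp iota iota X) at 2.
  rewrite !compA -fmap_comp iota_n (natural iota) (comp_eq (mA X)).
  now simpl; rewrite !fmap_comp !compA.
Qed.

End Premonad.

Section WeakComposite.
Variables (C : category) (R S : monad C) (sigma : bracket R S).

Definition composite_unit : nattrans (fid C) (fcomp R S).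
Proof.
exists (hcomp (eta R) (eta S)).
exact (natural (hcomp (eta R) (eta S))).
Defined.

Definition composite_mult : nattrans (fcomp (fcomp R S) (fcomp R S)) (fcomp R S).
Proof.
exists (fun X => hcomp (mu R) (mu S) X ∘ fmap R (sigma (S X))).
intros X Y f.
pose proof (natural (hcomp (mu R) (mu S)) f) as E1.
pose proof (natural sigma (fmap S f)) as E2.
simpl in E1, E2 |- *.
rewrite !compA -fmap_comp E2 fmap_comp -!compA.
rewrite -!compA in E1; now rewrite E1.
Defined.

Hypothesis Hsigma : weak_distributive_law R S sigma.

Let d X : hom (S (R (S X))) (R (S X)) := fmap R (mu S X) ∘ sigma (S X).

Lemma composite_multE X : composite_mult X = mu R (S X) ∘ fmap R (d X).
Proof. now unfold d; simpl; cat_norm. Qed.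

Lemma composite_mult_assoc X :
  composite_mult X ∘ composite_mult (fcomp R S X)
  = composite_mult X ∘ fmap (fcomp R S) (composite_mult X).
Proof.
destruct Hsigma as [_ [mup mum]].
assert (dp : d X ∘ fmap S (mu R (S X))
             = mu R (S X) ∘ fmap R (d X) ∘ sigma (R (S X))).
{ pose proof (natural (mu R) (mu S X)) as E; simpl in E.
  unfold d; cat_norm; rewrite mup.
  now rewrite -!compA -E; cat_norm. }
assert (dm : d X ∘ mu S (R (S X)) = d X ∘ fmap S (d X)).
{ pose proof (natural sigma (mu S X)) as E; simpl in E.
  unfold d; cat_norm; rewrite mum.
  crw E; rewrite -!compA -!fmap_comp.
  now rewrite -mu_mu. }
have dE : d (R (S X)) = fmap R (mu S (R (S X))) ∘ sigma (S (R (S X))) by [].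
pose proof composite_multE as mE; rewrite !mE; clear mE; clearbody d.
simpl; cat_norm.
pose proof (natural (mu R) (d X)) as E1; simpl in E1.
rewrite (comp_eq (eq_sym E1)); cat_norm.
rewrite (comp_eq (mu_mu R _)); cat_norm.
rewrite -!fmap_comp.
do 2 f_equal; rewrite fmap_comp (comp_eq dp); cat_norm; f_equal.
pose proof (natural sigma (d X)) as E2; simpl in E2.
rewrite E2 dE.
now rewrite -!compA -!fmap_comp -dm.
Qed.

Lemma composite_mult_unitr X :
  composite_mult X ∘ fmap (fcomp R S) (composite_unit X) = idm (fcomp R S X).
Proof.
destruct Hsigma as [etap _].
assert (de : d X ∘ fmap S (eta R (S X) ∘ eta S X) = eta R (S X)).
{ pose proof (natural (eta R) (mu S X)) as E; simpl in E.
  unfold d; cat_norm; crw (etap (S X)).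
  now rewrite (comp_eq (eq_sym E)) compA mu_etar comp_idr. }
rewrite composite_multE; simpl.
now rewrite compA -fmap_comp de mu_etar.
Qed.

Lemma composite_mult_unitl X :
  composite_mult X ∘ composite_unit (fcomp R S X) = kappa sigma X.
Proof.
have kE : kappa sigma X = d X ∘ eta S (R (S X)) by unfold d; rewrite compA.
rewrite kE composite_multE; clearbody d.
pose proof (natural (eta R) (d X)) as E; simpl in E |- *.
now rewrite !compA (comp_eq (eq_sym E)) compA (comp_eq (mu_etal R _)) comp_idl.
Qed.

Lemma kappa_idempotent X : idempotent (kappa sigma X).
Proof.
exact (premonad_kk composite_mult_assoc composite_mult_unitr
         composite_mult_unitl X).
Qed.

Variable s : splitting (kappa sigma).

Definition weak_composite_unit : nattrans (fid C) (split_fun s).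
Proof.
exists (fun X => split_pi s X ∘ hcomp (eta R) (eta S) X).
exact (natural (vcomp (split_pi s) composite_unit)).
Defined.

Definition weak_composite_mult :
  nattrans (fcomp (split_fun s) (split_fun s)) (split_fun s).
Proof.
exists (fun X => split_pi s X ∘ hcomp (mu R) (mu S) X ∘ fmap R (sigma (S X))
                 ∘ hcomp (split_iota s) (split_iota s) X).
intros X Y f.
pose proof (natural (vcomp (split_pi s) (vcomp composite_mult
  (hcomp (split_iota s) (split_iota s)))) f) as E.
now simpl in E |- *; rewrite !compA in E |- *.
Defined.


Lemma weak_composite_multE X :
  weak_composite_mult X
  = split_pi s X ∘ composite_mult X ∘ hcomp (split_iota s) (split_iota s) X.
Proof. now simpl; rewrite !compA. Qed.

(* The monad R •_sigma S on the functor [split_fun s]. *)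
Definition weak_composite : monad C.
Proof.
exists (split_fun s) weak_composite_unit weak_composite_mult.
- intros X; rewrite weak_composite_multE.
  exact (premonad_split_etal composite_mult_unitr composite_mult_unitl s X).
- intros X; rewrite weak_composite_multE.
  exact (premonad_split_etar composite_mult_unitr composite_mult_unitl s X).
- intros X; rewrite !weak_composite_multE.
  exact (premonad_split_assoc composite_mult_assoc
           composite_mult_unitl s X).
Defined.

End WeakComposite.

(* The splitting over which the theorem quantifies always exists.             *)
Lemma weak_composite_splitting_exists (C : category) (R S : monad C)
    (sigma : bracket R S) :
  idempotent_complete C -> weak_distributive_law R S sigma ->
  inhabited (splitting (kappa sigma)).
Proof.
intros HC Hs; apply (idempotent_nattrans_splits HC (kappa_idempotent Hs)).
Qed.

Definition phi (C : category) (R S T : monad C) (lam : bracket S T)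
  (sigma : bracket R S) (tau : bracket R T) (s : splitting (kappa sigma)) :
  bracket (split_fun s) T.
Proof.
exists (fun X => split_pi s (T X) ∘ fmap R (lam X) ∘ tau (S X)
                 ∘ fmap T (split_iota s X)).
intros X Y f.
pose proof (natural (split_iota s) f) as E1.
pose proof (natural tau (fmap S f)) as E2.
pose proof (natural lam f) as E3.
pose proof (natural (split_pi s) (fmap T f)) as E4.
simpl in E1, E2, E3, E4 |- *.
rewrite !compA -fmap_comp E1 fmap_comp (comp_eq E2) compA.
rewrite -(compA (fmap R (lam Y))) -fmap_comp E3 fmap_comp compA.
now rewrite (comp_eq E4) !compA.
Defined.

(* Main.v *)
From Stdlib Require Import ssreflect.
Require Import Defs.

(** The composite RS is a premonad: its multiplication m is associative, but its
    unit e is only a right unit, and kappa = m . e(RS).  The transformation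
    psi = R lam . tau S : T(RS) => (RS)T satisfies the axioms (eta+), (mu+) (by
    Yang-Baxter) and (mu-) with respect to e and m.  The first two give
    psi . T kappa = kappa T . psi, so psi restricts along the splitting of kappa:
    iota T . phi = psi . T iota.  The axioms for phi then follow from those for
    psi. *)

Set Implicit Arguments.
Unset Strict Implicit.
Unset Printing Implicit Defensive.

Local Open Scope cat_scope.

(** * Restricting a law along the splitting of a premonad idempotent *)

Section PremonadLaw.
Variables (C : category) (F : endofunctor C).
Variables (e : nattrans (fid C) F) (m : nattrans (fcomp F F) F).
Variables (k : nattrans F F) (s : splitting k).
Hypothesis kE : forall X, m X ∘ e (F X) = k X.

Variables (T : monad C) (psi : bracket F T).
Hypothesis psi_e : forall X, psi X ∘ fmap T (e X) = e (T X).
Hypothesis psi_m : forall X,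
  psi X ∘ fmap T (m X) = m (T X) ∘ fmap F (psi X) ∘ psi (F X).

Let H := split_fun s.
Let pi := split_pi s.
Let iota := split_iota s.

(** A bare family suffices here: naturality is carried by [phi], which [phiE] identifies with this
    family. *)
Definition premonad_split_law X : hom (T (H X)) (H (T X)) :=
  pi (T X) ∘ psi X ∘ fmap T (iota X).

Let p := premonad_split_law.

(** Expand [k] as [m] after [e]: [psi_m] and [psi_e] carry both across [psi], and naturality of [e]
    reassembles [k] on the other side. *)
Lemma premonad_law_k X : psi X ∘ fmap T (k X) = k (T X) ∘ psi X.
Proof.
pose proof (natural e (psi X)) as E; simpl in E.
rewrite -!kE; cat_norm; rewrite (comp_eq (psi_m X)); cat_norm.
by rewrite psi_e E.
Qed.

(** [iota] after [pi] is [k], which crosses [psi] and is then absorbed by [iota]. Together with its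
    dual [premonad_split_law_pi], this trades [p] for [psi]. *)
Lemma premonad_split_law_iota X : iota (T X) ∘ p X = psi X ∘ fmap T (iota X).
Proof.
rewrite /p /premonad_split_law (comp_eq (iota_pi s (T X))).
rewrite (comp_eq (eq_sym (premonad_law_k X))) compA -fmap_comp.
by rewrite -(iota_pi s X) compA pi_iota comp_idr.
Qed.

Lemma premonad_split_law_pi X : p X ∘ fmap T (pi X) = pi (T X) ∘ psi X.
Proof.
rewrite /p /premonad_split_law !compA -fmap_comp iota_pi premonad_law_k.
by rewrite -(iota_pi s) -!compA (pi_iota s) comp_idl.
Qed.

Lemma premonad_split_eta_plus X :
  p X ∘ fmap T (pi X ∘ e X) = pi (T X) ∘ e (T X).
Proof.
by rewrite fmap_comp (comp_eq (premonad_split_law_pi X)) compA psi_e.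
Qed.

Let n X := pi X ∘ m X ∘ hcomp iota iota X.

Lemma premonad_split_mu_plus X :
  p X ∘ fmap T (n X) = n (T X) ∘ fmap H (p X) ∘ p (H X).
Proof.
have p_iota := premonad_split_law_iota X.
have p_iotaH := premonad_split_law_iota (H X).
have p_pi := premonad_split_law_pi X; clearbody p.
pose proof (natural iota (p X)) as E1.
pose proof (natural psi (iota X)) as E2.
have E3 Y : hcomp iota iota Y = fmap F (iota Y) ∘ iota (H Y)
  by exact: (natural iota (iota Y)).
rewrite /n !E3 fmap_comp (comp_eq p_pi).
simpl in *; cat_norm; rewrite (comp_eq (psi_m X)); cat_norm.
(* On the right, naturality moves [iota] past [fmap H (p X)], so that each of the two factors [p]
   meets an [iota] and turns into [psi]. *)
rewrite (comp_eq E1) compA p_iotaH.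
rewrite (comp_eq E2) compA.
rewrite -(compA (fmap F (iota (T X)))) -fmap_comp p_iota.
by cat_norm.
Qed.

Hypothesis psi_mu : forall X,
  psi X ∘ mu T (F X) = fmap F (mu T X) ∘ psi (T X) ∘ fmap T (psi X).

Lemma premonad_split_mu_minus X :
  p X ∘ mu T (H X) = fmap H (mu T X) ∘ p (T X) ∘ fmap T (p X).
Proof.
pose proof (natural (mu T) (iota X)) as E1.
pose proof (natural pi (mu T X)) as E2.
(* Only the outer [p (T X)] is unfolded: its [iota] then meets the inner [p X] under [T]. *)
simpl in *; rewrite {2}/p /premonad_split_law !compA.
rewrite -!fmap_comp premonad_split_law_iota fmap_comp.
rewrite (comp_eq (eq_sym E2)) /p /premonad_split_law !compA -E1.
by rewrite (comp_eq (psi_mu X)) !compA.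
Qed.

Hypothesis psi_eta : forall X, psi X ∘ eta T (F X) = fmap F (eta T X).

Lemma premonad_split_eta_minus X : p X ∘ eta T (H X) = fmap H (eta T X).
Proof.
pose proof (natural (eta T) (iota X)) as E1.
pose proof (natural pi (eta T X)) as E2.
simpl in *; rewrite /p /premonad_split_law !compA -E1.
rewrite (comp_eq (psi_eta X)) (comp_eq E2) compA /pi /iota pi_iota.
by rewrite comp_idr.
Qed.

End PremonadLaw.

(** * The law of [T] over the premonad RS *)

Section CompositeLaw.
Variables (C : category) (R S T : monad C).
Variables (lam : bracket S T) (sigma : bracket R S) (tau : bracket R T).

Definition composite_law : bracket (fcomp R S) T.
Proof.
exists (fun X => fmap R (lam X) ∘ tau (S X)).
intros X Y f.
pose proof (natural tau (fmap S f)) as E1.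
pose proof (natural lam f) as E2.
simpl in *; rewrite compA E1 -!compA -!fmap_comp.
by rewrite E2.
Defined.

Lemma composite_law_unit X :
  eta_plus (A := S) lam -> eta_plus (A := R) tau ->
  composite_law X ∘ fmap T (composite_unit R S X) = composite_unit R S (T X).
Proof.
move=> lame taue; pose proof (natural (eta R) (lam X)) as E1.
simpl in *; cat_norm; rewrite (comp_eq (taue (S X))) (comp_eq (eq_sym E1)) compA.
by rewrite lame.
Qed.

Lemma composite_law_mult X :
  mu_plus (A := S) lam -> mu_plus (A := R) tau -> yang_baxter lam sigma tau ->
  composite_law X ∘ fmap T (composite_mult sigma X)
  = composite_mult sigma (T X) ∘ fmap (fcomp R S) (composite_law X)
    ∘ composite_law (fcomp R S X).
Proof.
move=> lamm taum YB.
(* This remains once [mu R], the outer [R] and the rightmost [tau] are cancelled. It follows from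
   Yang-Baxter at [S X] and (mu+) for [lam]. *)
assert (inner : fmap R (lam X) ∘ tau (S X)
                  ∘ fmap T (fmap R (mu S X) ∘ sigma (S X))
                = fmap R (mu S (T X)) ∘ sigma (S (T X))
                  ∘ fmap S (fmap R (lam X) ∘ tau (S X)) ∘ lam (R (S X))).
{ pose proof (natural tau (mu S X)) as E1.
  pose proof (natural sigma (lam X)) as E2.
  simpl in *; cat_norm; rewrite (comp_eq E1) (comp_eq E2) !compA YB.
  by rewrite -!compA -!fmap_comp lamm !compA. }
pose proof (natural tau (fmap R (mu S X) ∘ sigma (S X))) as E1.
pose proof (natural (mu R) (lam X)) as E2.
(* [T] is distributed over the leading [mu R] only; the rest stays [fmap R] of a single map, as
   naturality of [tau] requires. *)
simpl in *; rewrite !compA -!fmap_comp [fmap T (mu R _ ∘ _)]fmap_comp.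
rewrite (comp_eq (taum (S X))) !compA E1 (comp_eq (eq_sym E2)).
rewrite compA; f_equal.
rewrite -!compA -!fmap_comp; f_equal.
by rewrite !compA inner.
Qed.

Lemma composite_law_mu_minus X :
  mu_minus (B := T) lam -> mu_minus (B := T) tau ->
  composite_law X ∘ mu T (fcomp R S X)
  = fmap (fcomp R S) (mu T X) ∘ composite_law (T X) ∘ fmap T (composite_law X).
Proof.
move=> lamm taum; pose proof (natural tau (lam X)) as E.
simpl in *; cat_norm; rewrite taum (comp_eq E) !compA.
by rewrite -!compA -!fmap_comp lamm !compA.
Qed.

Lemma composite_law_eta_minus X :
  eta_minus (B := T) lam -> eta_minus (B := T) tau ->
  composite_law X ∘ eta T (fcomp R S X) = fmap (fcomp R S) (eta T X).
Proof. by move=> lame taue; rewrite /= compA taue -fmap_comp lame. Qed.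

End CompositeLaw.

Lemma phiE (C : category) (R S T : monad C) (lam : bracket S T)
    (sigma : bracket R S) (tau : bracket R T) (s : splitting (kappa sigma)) X :
  phi lam tau s X = premonad_split_law s (composite_law lam tau) X.
Proof. by rewrite /premonad_split_law /= !compA. Qed.

Theorem theorem4p3 (C : category) (HC : idempotent_complete C)
    (R S T : monad C)
    (lam : bracket S T) (sigma : bracket R S) (tau : bracket R T)
    (Hlam : weak_distributive_law S T lam)
    (Hsigma : weak_distributive_law R S sigma)
    (Htau : weak_distributive_law R T tau)
    (YB : yang_baxter lam sigma tau)
    (s : splitting (kappa sigma)) :
  weak_distributive_law (weak_composite Hsigma s) T (phi lam tau s) /\
  (distributive_law R T tau -> distributive_law S T lam ->
   distributive_law (weak_composite Hsigma s) T (phi lam tau s)).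
Proof.
case: Hlam => lam_eta [lam_mup lam_mum]; case: Htau => tau_eta [tau_mup tau_mum].
have kE := composite_mult_unitl sigma.
have psi_e X := composite_law_unit X lam_eta tau_eta.
have psi_m X := composite_law_mult X lam_mup tau_mup YB.
have psi_mu X := composite_law_mu_minus X lam_mum tau_mum.
have etap : eta_plus (A := weak_composite Hsigma s) (phi lam tau s).
{ move=> X; rewrite phiE.
  exact: (premonad_split_eta_plus s kE psi_e psi_m X). }
have mup : mu_plus (A := weak_composite Hsigma s) (phi lam tau s).
{ move=> X; rewrite !phiE.
  (* Exposes the multiplication in the form of [n]: [pi], the premonad multiplication, then two
     copies of [iota]. *)
  change (mu (weak_composite Hsigma s)) with (weak_composite_mult s).
  rewrite !weak_composite_multE.
  exact: (premonad_split_mu_plus s kE psi_e psi_m X). }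
have mum : mu_minus (A := weak_composite Hsigma s) (B := T) (phi lam tau s).
{ move=> X; rewrite !phiE.
  exact: (premonad_split_mu_minus s kE psi_e psi_m psi_mu X). }
split=> // - [_ [_ [tau_etam _]]] [_ [_ [lam_etam _]]].
(* The other three axioms are those of the weak law; only (eta-) remains. *)
do 3![split=> //] => X; rewrite phiE.
exact: (premonad_split_eta_minus s
          (fun Y => composite_law_eta_minus Y lam_etam tau_etam) X).
Qed.
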